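(* Let $\Sigma=(A,B,C,D;\mathcal X,\mathcal U,\mathcal Y)$ be a minimal system. If the set $\mathrm{RE}_\Sigma$ of generalized solutions of the Riccati equation associated to $\Sigma$ is nonempty, then the transfer function $\theta_\Sigma$ coincides with a Schur class function in a neighborhood of zero.
   Context: A system $\Sigma=(A,B,C,D;\mathcal X,\mathcal U,\mathcal Y)$ is the discrete time-invariant linear system $x_{n+1}=Ax_n+Bu_n$, $y_n=Cx_n+Du_n$ $(n\ge 0)$, where $A:\mathcal X\to\mathcal X$, $B:\mathcal U\to\mathcal X$, $C:\mathcal X\to\mathcal Y$, $D:\mathcal U\to\mathcal Y$ are bounded linear operators between separable (complex) Hilbert spaces. Its transfer function is $\theta_\Sigma(\lambda)=D+\lambda C(I-\lambda A)^{-1}B$, defined for those $\lambda\in\mathbb C$ for which $I-\lambda A$ is boundedly invertible. Put $\operatorname{Im}(A|B)=\operatorname{span}\{\operatorname{Im}A^nB\mid n\ge 0\}$ (linear span, not closed) and $\operatorname{Ker}(C|A)=\bigcap_{n\ge0}\operatorname{Ker}CA^n$. $\Sigma$ is minimal if $\operatorname{Im}(A|B)$ is dense in $\mathcal X$ and $\operatorname{Ker}(C|A)=\{0\}$. The Schur class $\mathcal S(\mathcal U,\mathcal Y)$ consists of the functions $\theta$ analytic on the open unit disc $\mathbb D$ with values bounded operators $\mathcal U\to\mathcal Y$ with $\|\theta(z)\|\le1$ for all $z\in\mathbb D$. For a bounded selfadjoint operator $T$ on a Hilbert space $\mathcal H$, put $\mathcal H_1=\overline{T\mathcal H}$, $\mathcal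 H_2=\operatorname{Ker}T=\mathcal H\ominus\mathcal H_1$, $T_1=T|_{\mathcal H_1}$ (injective on $\mathcal H_1$). The Moore--Penrose pseudo-inverse $T^{[-1]}$ is the (possibly unbounded) selfadjoint operator with domain $\operatorname{Im}T_1\oplus\mathcal H_2$ acting as $T_1^{-1}$ on $\operatorname{Im}T_1$ and as $0$ on $\mathcal H_2$. $\mathcal D(\cdot)$ denotes the domain of an operator. A (possibly unbounded) selfadjoint operator $H$ in $\mathcal X$ is a generalized solution of the Riccati equation associated to $\Sigma$ if the following four conditions hold: (1) $\langle Hx,x\rangle>0$ for each $0\ne x\in\mathcal D(H)$; (2) $A\mathcal D(H^{1/2})\subset\mathcal D(H^{1/2})$ and $B\mathcal U\subset\mathcal D(H^{1/2})$ (so $H^{1/2}B:\mathcal U\to\mathcal X$ is bounded); (3) the operator $\delta_\Sigma(H)=I_{\mathcal U}-D^*D-(H^{1/2}B)^*H^{1/2}B$ is bounded and nonnegative, and $\big(D^*C+(H^{1/2}B)^*H^{1/2}A\big)\mathcal D(H^{1/2})\subset\delta_\Sigma(H)^{1/2}\mathcal U$; (4) for each $x\in\mathcal D(H^{1/2})$, $$\|H^{1/2}x\|^2-\|H^{1/2}Ax\|^2-\|Cx\|^2=\big\|\big(\delta_\Sigma(H)^{1/2}\big)^{[-1]}\big(D^*C+(H^{1/2}B)^*H^{1/2}A\big)x\big\|^2 .$$ $\mathrm{RE}_\Sigma$ denotes the set of all such $H$. *)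

(* Defs.v *)
From HB Require Import structures.
From mathcomp Require Import all_boot all_order all_algebra.
From mathcomp Require Import complex.
From mathcomp Require Import all_classical all_reals.
From mathcomp Require Import topology normedtype.

Set Implicit Arguments.
Unset Strict Implicit.
Unset Printing Implicit Defensive.

Import Order.TTheory GRing.Theory Num.Theory Num.Def.

Local Open Scope classical_set_scope.
Local Open Scope ring_scope.

(* Complex Hilbert spaces. The inner product is linear in the first argument;
   norms and inner products take values in R[i], where 0 <= z (resp. 0 < z)
   means that z is real and nonnegative (resp. positive). *)
HB.mixin Record isHilbert (R : realType) (X : Type)
    of CompleteNormedModule R[i] X := {
  inner : {dot X for @conjC R[i]} ;
  inner_norm : forall x : X, `|x| ^+ 2 = inner x x }.

#[short(type="hilbertType")]
HB.structure Definition Hilbert (R : realType) :=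
  {X of CompleteNormedModule R[i] X & isHilbert R X}.

Notation "''[' x , y ]" := (inner x y) (format "''[' x ,  y ]") : ring_scope.

Definition separable (T : topologicalType) :=
  exists D : set T, countable D /\ dense D.

Section Operators.
Variable R : realType.
Implicit Types X Y Z : hilbertType R.

(* For M >= 0, this is the operator norm inequality ||f|| <= M. *)
Definition bounded_by X Y (f : X -> Y) (M : R[i]) :=
  forall x, `|f x| <= M * `|x|.

Definition bounded_operator X Y (f : X -> Y) :=
  linear f /\ exists M, bounded_by f M.

(* The adjoint of an everywhere defined bounded operator: by the Riesz theorem
   the set below is a singleton (0 is the default if it is empty). *)
Definition adjoint X Y (f : X -> Y) (y : Y) : X :=
  xget 0 [set x | forall v, '[f v, y] = '[v, x]].

(* (Possibly unbounded) linear operators; the values of [app] outside [dom]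
   are irrelevant. *)
Record operator X := Operator {
  dom : set X ;
  app :> X -> X ;
  dom0 : dom 0 ;
  dom_linear : forall a x y, dom x -> dom y -> dom (a *: x + y) ;
  app_linear : forall a x y, dom x -> dom y ->
    app (a *: x + y) = a *: app x + app y }.

Definition graph X (T : operator X) : set (X * X) :=
  [set p | dom T p.1 /\ T p.1 = p.2].

Definition adjoint_graph X (T : operator X) : set (X * X) :=
  [set p | forall x, dom T x -> '[T x, p.1] = '[x, p.2]].

Definition selfadjoint X (T : operator X) :=
  dense (dom T) /\ adjoint_graph T = graph T.

(* S is the (unique) nonnegative selfadjoint operator such that S^2 = H, where
   the domain of S^2 is the set of all x in dom S such that S x is in dom S. *)
Definition is_sqrt X (H S : operator X) :=
  [/\ selfadjoint S,
      forall x, dom S x -> 0 <= '[S x, x],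
      dom H = [set x | dom S x /\ dom S (S x)] &
      forall x, dom H x -> H x = S (S x)].

Definition nonnegative X (T : X -> X) := forall x, 0 <= '[T x, x].

Definition bounded_selfadjoint X (T : X -> X) :=
  bounded_operator T /\ forall x y, '[T x, y] = '[x, T y].

Definition is_bounded_sqrt X (P T : X -> X) :=
  [/\ bounded_selfadjoint T, nonnegative T & forall x, P x = T (T x)].

(* The Moore-Penrose pseudo-inverse of a bounded selfadjoint operator T.
   A vector y of its domain is uniquely of the form T x + k with x in the
   closure of the range of T and k in Ker T, and is then mapped to x. *)
Definition pseudo_inverse X (T : X -> X) (y : X) : X :=
  xget 0 [set x | closure (range T) x /\ exists2 k, T k = 0 & y = T x + k].

Definition boundedly_invertible X (T : X -> X) :=
  exists V : X -> X, [/\ bounded_operator V, cancel T V & cancel V T].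

Definition inverse X (T : X -> X) (y : X) : X := xget 0 [set x | T x = y].

Definition linear_span X (E : set X) : set X :=
  [set x | exists (n : nat) (c : 'I_n -> R[i]) (v : 'I_n -> X),
     (forall i, E (v i)) /\ x = \sum_(i < n) c i *: v i].

Definition op_differentiable_at X Y (theta : R[i] -> X -> Y) (z : R[i]) :=
  exists2 L : X -> Y, bounded_operator L &
    forall e : R[i], 0 < e -> exists2 d : R[i], 0 < d &
      forall h, 0 < `|h| -> `|h| < d ->
        bounded_by
          (fun x => h^-1 *: (theta (z + h) x - theta z x) - L x) e.

(* The functions are total; only their restrictions to the open unit disc
   matter. Analyticity is complex differentiability in operator norm. *)
Definition schur_class X Y (theta : R[i] -> X -> Y) :=
  forall z : R[i], `|z| < 1 ->
    [/\ bounded_operator (theta z), op_differentiable_at theta z &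
        bounded_by (theta z) 1].

End Operators.

Record linear_system (R : realType) (X U Y : hilbertType R) := LinearSystem {
  sysA : {linear X -> X} ;
  sysB : {linear U -> X} ;
  sysC : {linear X -> Y} ;
  sysD : {linear U -> Y} ;
  sysA_bounded : bounded_operator sysA ;
  sysB_bounded : bounded_operator sysB ;
  sysC_bounded : bounded_operator sysC ;
  sysD_bounded : bounded_operator sysD }.

Section Systems.
Variables (R : realType) (X U Y : hilbertType R).
Variable Sigma : linear_system X U Y.

Local Notation A := (sysA Sigma).
Local Notation B := (sysB Sigma).
Local Notation C := (sysC Sigma).
Local Notation D := (sysD Sigma).

Definition pencil (l : R[i]) (x : X) : X := x - l *: A x.

Definition transfer_dom : set R[i] :=
  [set l | boundedly_invertible (pencil l)].

Definition transfer (l : R[i]) (u : U) : Y :=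
  D u + l *: C (inverse (pencil l) (B u)).

Definition reachable : set X :=
  linear_span [set x | exists n u, x = iter n A (B u)].

Definition unobservable : set X :=
  [set x | forall n, C (iter n A x) = 0].

Definition minimal := dense reachable /\ unobservable = [set 0].

(* In the next two definitions S stands for H^{1/2}. *)
Definition delta (S : operator X) (u : U) : U :=
  u - adjoint D (D u) - adjoint (S \o B) (S (B u)).

Definition cross (S : operator X) (x : X) : U :=
  adjoint D (C x) + adjoint (S \o B) (S (A x)).

(* The square roots S of H and T of delta S are uniquely determined. *)
Definition generalized_riccati_solution (H : operator X) :=
  [/\ selfadjoint H,
      forall x, dom H x -> x != 0 -> 0 < '[H x, x] &
      exists2 S, is_sqrt H S &
        [/\ forall x, dom S x -> dom S (A x),
            forall u, dom S (B u),
            bounded_operator (delta S),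
            nonnegative (delta S) &
            exists2 T, is_bounded_sqrt (delta S) T &
              (forall x, dom S x -> range T (cross S x)) /\
              (forall x, dom S x ->
                 `|S x| ^+ 2 - `|S (A x)| ^+ 2 - `|C x| ^+ 2
                 = `|pseudo_inverse T (cross S x)| ^+ 2)]].

Definition riccati_solutions : set (operator X) :=
  [set H | generalized_riccati_solution H].

End Systems.

(* Main.v *)
Require Import Defs.
From HB Require Import structures.
From mathcomp Require Import all_boot all_order all_algebra.
From mathcomp Require Import complex.
From mathcomp Require Import all_classical all_reals.
From mathcomp Require Import topology normedtype.
From mathcomp Require Import ring lra.

Set Implicit Arguments.
Unset Strict Implicit.
Unset Printing Implicit Defensive.

Import Order.TTheory GRing.Theory Num.Theory.

Local Open Scope classical_set_scope.
Local Open Scope ring_scope.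

(** With [S = H^{1/2}], completing the square in the Riccati equation gives the
    dissipation inequality
      |S (A x + B u)|^2 + |C x + D u|^2 <= |S x|^2 + |u|^2   (x in dom S).
    Along the trajectories starting at 0 it shows that the Taylor coefficients
    D, C B, C A B, ... of the transfer function are contractions, so that their
    power series converges in the unit disc, and that its sum is a contraction
    at each point. Near 0 the Neumann series identifies this sum with the
    transfer function. *)

(** Two obstacles come from the unboundedness of [S]. First, [delta] and [cross] contain the adjoint
    of [S \o B], which has its meaning only once [S \o B] is known to be bounded. The definition of
    a solution does not state this bound, so it is derived from the selfadjointness of [S] and from
    the inclusion of the range of [B] in [dom S]. Second, for a point z of the disc the infinite
    state sum of the [z ^+ k.+1 *: A ^ k B u] need not converge, and a limit need not lie in
    [dom S], so the dissipation inequality cannot be applied to it. It is applied to the finite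
    partial sums, which do lie in [dom S]; the convergence of the outputs alone and the
    nonnegativity of the storage |S x|^2 then force the contraction bound. *)

Section RealNorm.
Variable R : realType.

(** Norms live in [R[i]], whose order is only partial. Their real parts live in an ordered field,
    where case distinctions and [lra] are available. *)
Definition nrm (V : normedZmodType R[i]) (x : V) : R := complex.Re `|x|.

Lemma nrmE (V : normedZmodType R[i]) (x : V) : `|x| = (nrm x)%:C%C.
Proof. by rewrite /nrm RRe_real // normr_real. Qed.

Lemma ler_nrm (V W : normedZmodType R[i]) (x : V) (y : W) :
  (`|x| <= `|y|) = (nrm x <= nrm y).
Proof. by rewrite !nrmE lecR. Qed.

Lemma nrm_ge0 (V : normedZmodType R[i]) (x : V) : 0 <= nrm x.
Proof. by rewrite -lecR -nrmE normr_ge0. Qed.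

Lemma nrm0 (V : normedZmodType R[i]) : nrm (0 : V) = 0.
Proof. by rewrite /nrm normr0. Qed.

Lemma nrm_eq0 (V : normedZmodType R[i]) (x : V) : (nrm x == 0) = (x == 0).
Proof. by rewrite -(inj_eq (@complexI R)) -nrmE normr_eq0. Qed.

Lemma nrm_gt0 (V : normedZmodType R[i]) (x : V) : (0 < nrm x) = (x != 0).
Proof. by rewrite lt_def nrm_eq0 nrm_ge0 andbT. Qed.

Lemma nrmN (V : normedZmodType R[i]) (x : V) : nrm (- x) = nrm x.
Proof. by rewrite /nrm normrN. Qed.

Lemma nrm_distC (V : normedZmodType R[i]) (x y : V) : nrm (x - y) = nrm (y - x).
Proof. by rewrite -nrmN opprB. Qed.

Lemma nrmD (V : normedZmodType R[i]) (x y : V) : nrm (x + y) <= nrm x + nrm y.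
Proof. by rewrite -lecR rmorphD /= -!nrmE ler_normD. Qed.

Lemma nrmB (V : normedZmodType R[i]) (x y : V) : nrm (x - y) <= nrm x + nrm y.
Proof. by rewrite (le_trans (nrmD _ _)) // nrmN. Qed.

Lemma nrm_triangle (V : normedZmodType R[i]) (y x z : V) :
  nrm (x - z) <= nrm (x - y) + nrm (y - z).
Proof. by have := nrmD (x - y) (y - z); rewrite addrA subrK. Qed.

Lemma nrm_sum (V : normedZmodType R[i]) (F : nat -> V) (G : nat -> R) n :
  (forall k, nrm (F k) <= G k) ->
  nrm (\sum_(0 <= k < n) F k) <= \sum_(0 <= k < n) G k.
Proof.
move=> FG; elim: n => [|n IH]; first by rewrite !big_nil nrm0.
by rewrite !big_nat_recr //= (le_trans (nrmD _ _)) // lerD.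
Qed.

Lemma nrmZ (V : normedModType R[i]) a (x : V) : nrm (a *: x) = nrm a * nrm x.
Proof.
by apply: complexI; rewrite rmorphM /= -!nrmE normrZ.
Qed.

Lemma nrmM (a b : R[i]) : nrm (a * b) = nrm a * nrm b.
Proof. by apply: complexI; rewrite rmorphM /= -!nrmE normrM. Qed.

Lemma nrm1 : nrm (1 : R[i]) = 1.
Proof. by rewrite /nrm normr1. Qed.

Lemma nrmX (a : R[i]) n : nrm (a ^+ n) = nrm a ^+ n.
Proof. by elim: n => [|n IH]; rewrite ?expr0 ?nrm1 // !exprS nrmM IH. Qed.

Lemma nrm_real (t : R) : nrm t%:C%C = `|t|.
Proof. by rewrite /nrm normc_def /= expr0n /= addr0 sqrtr_sqr. Qed.

Lemma nrm_nat n : nrm (n%:R : R[i]) = n%:R.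
Proof. by rewrite -(rmorph_nat (@real_complex R)) nrm_real normr_nat. Qed.

Lemma nrmJ (a : R[i]) : nrm (a^*)%C = nrm a.
Proof. by rewrite /nrm; case: a => x y; rewrite !normc_def /= sqrrN. Qed.

Lemma mulJ_nrm (a : R[i]) : a * (a^*)%C = (nrm a ^+ 2)%:C%C.
Proof. by rewrite rmorphXn /= -nrmE sqr_normc. Qed.

(** The bound [M] in [bounded_operator] is an arbitrary complex number. Its product with the norm of
    x dominates a norm, hence equals its own modulus, so [nrm M] serves as a real bound. *)
Lemma bounded_operatorP (X Y : hilbertType R) (f : X -> Y) :
  bounded_operator f <->
  linear f /\ exists2 M : R, 0 <= M & forall x, nrm (f x) <= M * nrm x.
Proof.
split=> -[lf]; last first.
  case=> M M0 fM; split=> //; exists M%:C%C => x.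
  by rewrite !nrmE -rmorphM lecR.
case=> M fM; split=> //; exists (nrm M) => [|x]; first exact: nrm_ge0.
have := fM x; rewrite -(ger0_norm (le_trans _ (fM x))) //.
by rewrite normrM normr_id !nrmE -rmorphM lecR.
Qed.

(** * Archimedean and geometric estimates *)

Lemma le_archi_inv (a b : R) :
  (forall n, a <= b + n.+1%:R^-1) -> a <= b.
Proof.
move=> h; rewrite leNgt; apply/negP => ba.
have d0 : 0 < a - b by rewrite subr_gt0.
have /ltr_add_invr [k hk] := ba.
by have := h k; rewrite leNgt hk.
Qed.

Lemma invS_small (e : R) : 0 < e -> exists n, n.+1%:R^-1 < e.
Proof. by move=> /ltr_add_invr [k]; rewrite add0r; exists k. Qed.

(** Bernoulli's inequality for [a^-1 = 1 + d] gives [n%:R * d * a ^+ n <= 1], so any n above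
    [K / (e * d)] works. *)
Lemma geometric_small (a K e : R) : 0 <= a < 1 -> 0 < e ->
  exists n, K * a ^+ n < e.
Proof.
move=> /andP[a0 a1] e0.
have [K0|K0] := leP K 0.
  by exists 0%N; rewrite expr0 mulr1 (le_lt_trans K0).
have [->|an0] := eqVneq a 0; first by exists 1%N; rewrite expr1 mulr0.
have ap : 0 < a by rewrite lt_def an0.
pose d := a^-1 - 1.
have d0 : 0 < d by rewrite subr_gt0 invf_gt1.
have bern n : n%:R * d <= (1 + d) ^+ n.
  elim: n => [|n IH]; first by rewrite mul0r expr0 ler01.
  have h1 : 1 <= (1 + d) ^+ n by rewrite exprn_ege1 // lerDl ltW.
  have h2 : d <= d * (1 + d) ^+ n by rewrite ler_peMr // ltW.
  by rewrite exprS -natr1; lra.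
have {}bern n : n%:R * d * a ^+ n <= 1.
  rewrite -ler_pdivlMr ?exprn_gt0 // div1r -exprVn.
  by rewrite (_ : a^-1 = 1 + d) // /d addrC subrK.
have [n hn] := invS_small (divr_gt0 (mulr_gt0 e0 d0) K0).
exists n.+1; have hb := bern n.+1.
have an : 0 < a ^+ n.+1 by rewrite exprn_gt0.
have nn : 0 < n.+1%:R :> R by rewrite ltr0n.
move: hn; rewrite ltr_pdivlMr // mulrC ltr_pdivrMr // => hn.
apply: (lt_le_trans (y := e * (n.+1%:R * d * a ^+ n.+1))).
  by rewrite [ltRHS](_ : _ = e * d * n.+1%:R * a ^+ n.+1) ?ltr_pM2r //; ring.
by rewrite -[leRHS]mulr1 ler_pM2l.
Qed.

(** This and [eq0_geometric] take the place of limits of series: sums are compared through explicit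
    remainders [K * a ^+ n]. *)
Lemma le_geometric (a b c K : R) : 0 <= a < 1 ->
  (forall n, b <= c + K * a ^+ n) -> b <= c.
Proof.
move=> a01 h; rewrite leNgt; apply/negP => cb.
have [n hn] := geometric_small K a01 (e := b - c) ltac:(by rewrite subr_gt0).
by have := h n; lra.
Qed.

Lemma eq0_geometric (V : normedZmodType R[i]) (x : V) (a K : R) : 0 <= a < 1 ->
  (forall n, nrm x <= K * a ^+ n) -> x = 0.
Proof.
move=> a01 h; apply/eqP; rewrite -nrm_eq0 eq_le nrm_ge0 andbT.
by apply: (le_geometric (K := K) a01) => n; rewrite add0r.
Qed.

Lemma sum_geometric_le (a : R) n : 0 <= a < 1 ->
  \sum_(0 <= k < n) a ^+ k <= (1 - a)^-1.
Proof.
move=> /andP[a0 a1]; have d0 : 0 < 1 - a by rewrite subr_gt0.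
rewrite -[leRHS]mul1r ler_pdivlMr // -[leRHS](subr0 1).
have -> : (\sum_(0 <= k < n) a ^+ k) * (1 - a) = 1 - a ^+ n.
  elim: n => [|n IH]; first by rewrite big_nil mul0r expr0 subrr.
  by rewrite big_nat_recr //= mulrDl IH exprS; ring.
by rewrite lerB // exprn_ge0.
Qed.

(** * Closure, density and completeness in terms of real norms *)

Lemma closureP_nrm (V : normedModType R[i]) (K : set V) x :
  closure K x <-> forall e, 0 < e -> exists2 k, K k & nrm (x - k) < e.
Proof.
split=> [cK e e0|h].
  have /cK [k [Kk]] : nbhs x (ball x e%:C%C).
    by apply: nbhsx_ballx; rewrite ltcR.
  by rewrite -ball_normE /= nrmE ltcR; exists k.
move=> N /nbhs_ballP [e /= e0 eN].
have er : e = (complex.Re e)%:C%C by rewrite RRe_real // gtr0_real.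
have [|k Kk xk] := h (complex.Re e); first by rewrite -ltcR -er.
by exists k; split => //; apply: eN; rewrite -ball_normE /= nrmE er ltcR.
Qed.

Lemma dense_nrm (V : normedModType R[i]) (K : set V) x e : dense K -> 0 < e ->
  exists2 k, K k & nrm (x - k) < e.
Proof.
move=> dK e0; have e0' : 0 < e%:C%C by rewrite ltcR.
have [||k [xk Kk]] := dK (ball x e%:C%C).
- by exists x; apply: ballxx.
- by apply: ball_open.
by exists k => //; move: xk; rewrite -ball_normE /= nrmE ltcR.
Qed.

Lemma cauchy_limit (V : completeNormedModType R[i]) (s : nat -> V)
    (e : nat -> R) :
  (forall n m, (n <= m)%N -> nrm (s m - s n) <= e n) ->
  (forall d, 0 < d -> exists n, e n < d) ->
  exists l, forall n, nrm (l - s n) <= e n.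
Proof.
move=> se e0.
have : cvg (s @ \oo).
  apply: cauchy_cvg; apply: cauchy_exP => d d0.
  have dr : d = (complex.Re d)%:C%C by rewrite RRe_real // gtr0_real.
  have [|N hN] := e0 (complex.Re d); first by rewrite -ltcR -dr.
  exists (s N); exists N => // n /= Nn.
  rewrite /= -ball_normE /= nrmE dr ltcR nrm_distC.
  by apply: le_lt_trans hN; apply: se.
move=> /cvg_ex [l sl]; exists l => n.
apply: le_archi_inv => k.
have k0 : 0 < (k.+1%:R^-1 : R)%:C%C by rewrite ltcR invr_gt0 ltr0n.
have /cvgrPdist_lt /(_ _ k0) [N _ hN] := sl.
have := hN (maxn N n) (leq_maxl _ _); rewrite nrmE ltcR => /ltW h1.
have h2 := se n (maxn N n) (leq_maxr _ _).
apply: le_trans (nrm_triangle (s (maxn N n)) _ _) _.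
by rewrite addrC lerD.
Qed.

End RealNorm.

(** * Inner products and their real parts *)

Section InnerProduct.
Variable R : realType.
Implicit Types X Y : hilbertType R.

Lemma innerDl X (x y z : X) : '[x + y, z] = '[x, z] + '[y, z].
Proof. exact: linearDl. Qed.

Lemma innerZl X a (x z : X) : '[a *: x, z] = a * '[x, z].
Proof. exact: linearZl_LR. Qed.

Lemma innerC X (x y : X) : '[x, y] = ('[y, x]^*)%C.
Proof. by rewrite hermC expr0 mul1r. Qed.

Lemma innerDr X (x y z : X) : '[z, x + y] = '[z, x] + '[z, y].
Proof. by rewrite innerC innerDl rmorphD /= -!innerC. Qed.

Lemma innerZr X a (x z : X) : '[z, a *: x] = (a^*)%C * '[z, x].
Proof. by rewrite innerC innerZl rmorphM /= -innerC. Qed.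

Lemma innerBl X (x y z : X) : '[x - y, z] = '[x, z] - '[y, z].
Proof. by rewrite innerDl -scaleN1r innerZl mulN1r. Qed.

Lemma innerBr X (x y z : X) : '[z, x - y] = '[z, x] - '[z, y].
Proof.
by rewrite innerDr -scaleN1r innerZr rmorphN rmorph1 mulN1r.
Qed.

Lemma inner0r X (z : X) : '[z, 0] = 0.
Proof. by rewrite -(scale0r 0) innerZr rmorph0 mul0r. Qed.

Lemma innerxx X (x : X) : '[x, x] = (nrm x ^+ 2)%:C%C.
Proof. by rewrite -inner_norm nrmE rmorphXn. Qed.

Definition ip X (x y : X) : R := complex.Re '[x, y].

Lemma ipDl X (x y z : X) : ip (x + y) z = ip x z + ip y z.
Proof. by rewrite /ip innerDl raddfD. Qed.

Lemma ipDr X (x y z : X) : ip z (x + y) = ip z x + ip z y.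
Proof. by rewrite /ip innerDr raddfD. Qed.

Lemma ipC X (x y : X) : ip x y = ip y x.
Proof. by rewrite /ip innerC; case: '[_, _]. Qed.

Lemma ipZl X (t : R) (x y : X) : ip (t%:C%C *: x) y = t * ip x y.
Proof. by rewrite /ip innerZl; case: '[_, _] => a b /=; ring. Qed.

Lemma ipNl X (x y : X) : ip (- x) y = - ip x y.
Proof. by rewrite /ip -scaleN1r innerZl mulN1r raddfN. Qed.

Lemma ipNr X (x y : X) : ip x (- y) = - ip x y.
Proof. by rewrite ipC ipNl ipC. Qed.

Lemma ipxx X (x : X) : ip x x = nrm x ^+ 2.
Proof. by rewrite /ip innerxx. Qed.

Lemma nrmD_sqr X (x y : X) :
  nrm (x + y) ^+ 2 = nrm x ^+ 2 + 2 * ip x y + nrm y ^+ 2.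
Proof. by rewrite -!ipxx ipDl !ipDr (ipC y x); ring. Qed.

Lemma nrmB_sqr X (x y : X) :
  nrm (x - y) ^+ 2 = nrm x ^+ 2 - 2 * ip x y + nrm y ^+ 2.
Proof. by rewrite nrmD_sqr ipNr nrmN; ring. Qed.

(** The square of the norm of [nrm y *: x - nrm x *: y] equals [2 * (nrm x * nrm y) * (nrm x * nrm y
    - ip x y)]. *)
Lemma ip_le X (x y : X) : ip x y <= nrm x * nrm y.
Proof.
have [->|x0] := eqVneq x 0.
  by rewrite nrm0 mul0r -(subrr 0) ipDl ipNl subrr.
have [->|y0] := eqVneq y 0.
  by rewrite nrm0 mulr0 -(subrr 0) ipDr ipNr subrr.
have xy : 0 < nrm x * nrm y by rewrite mulr_gt0 // nrm_gt0.
have := sqr_ge0 (nrm ((nrm y)%:C%C *: x - (nrm x)%:C%C *: y)).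
rewrite nrmB_sqr !nrmZ !nrm_real !ger0_norm ?nrm_ge0 //.
rewrite ipZl [ip x _]ipC ipZl [ip y x]ipC.
rewrite (_ : _ + _ = 2 * (nrm x * nrm y) * (nrm x * nrm y - ip x y)); last ring.
by rewrite pmulr_rge0 ?subr_ge0 // mulr_gt0.
Qed.

(** Multiplying x by the conjugate of the inner product makes the inner product real, which reduces
    the claim to [ip_le]. *)
Lemma cauchy_schwarz X (x y : X) : nrm '[x, y] <= nrm x * nrm y.
Proof.
have [->|c0] := eqVneq '[x, y] 0; first by rewrite nrm0 mulr_ge0 ?nrm_ge0.
rewrite -(ler_pM2l (_ : 0 < nrm '[x, y])) ?nrm_gt0 //.
have := ip_le (('[x, y]^*)%C *: x) y.
rewrite /ip innerZl [X in complex.Re X]mulrC mulJ_nrm /= nrmZ nrmJ.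
by rewrite -expr2 mulrA.
Qed.

Lemma inner_ip0 X (x y : X) : (forall a, ip (a *: x) y = 0) -> '[x, y] = 0.
Proof.
move=> h; have := h ('[x, y]^*)%C.
rewrite /ip innerZl [X in complex.Re X]mulrC mulJ_nrm /= => /eqP.
by rewrite sqrf_eq0 nrm_eq0 => /eqP.
Qed.

Lemma nrm_le_inner X (W : set X) (x : X) M : dense W -> 0 <= M ->
  (forall y, W y -> nrm '[x, y] <= M * nrm y) -> nrm x <= M.
Proof.
move=> dW M0 h; apply: le_archi_inv => n.
have [->|x0] := eqVneq x 0; first by rewrite nrm0 addr_ge0 ?invr_ge0.
have xp : 0 < nrm x by rewrite nrm_gt0.
set e : R := n.+1%:R^-1.
have e0 : 0 < e by rewrite invr_gt0.
(* Replacing x by a vector of [W] at distance below [d] costs at most [nrm x * d] and [M * d],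
   together [e * nrm x]. *)
pose d := e * nrm x / (nrm x + M).
have xM : 0 < nrm x + M by rewrite ltr_pwDl.
have d0 : 0 < d by rewrite divr_gt0 // mulr_gt0.
have dE : d * (nrm x + M) = e * nrm x by rewrite /d divfK // gt_eqF.
have [y Wy xy] := dense_nrm x dW d0.
have h1 := h y Wy.
have h2 := cauchy_schwarz x (x - y).
have h3 : nrm '[x, x] <= nrm '[x, x - y] + nrm '[x, y].
  by rewrite -[X in nrm X <= _](subrK '[x, y]) innerBr nrmD.
have h4 : nrm y <= nrm x + nrm (x - y).
  by rewrite -[y in nrm y](subKr x) nrmB.
move: h3; rewrite innerxx nrm_real ger0_norm ?sqr_ge0 // => h3.
rewrite -(ler_pM2l xp).
have h5 : nrm x * nrm (x - y) <= nrm x * d by rewrite ler_wpM2l ?ltW.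
have h6 : M * nrm y <= M * (nrm x + d).
  by rewrite ler_wpM2l // (le_trans h4) // lerD2l ltW.
by rewrite expr2 in h3; lra.
Qed.

(** * Orthogonal projection, Riesz representation, adjoints and pseudo-inverses *)

Definition subspace X (K : set X) :=
  K 0 /\ forall a x y, K x -> K y -> K (a *: x + y).

Lemma projection X (K : set X) (x : X) : subspace K ->
  exists2 p, closure K p & forall k, K k -> '[k, x - p] = 0.
Proof.
move=> [K0 KL].
have KZ a k : K k -> K (a *: k) by move=> Kk; rewrite -[_ *: _]addr0; apply: KL.
have KD k l : K k -> K l -> K (k + l).
  by move=> Kk Kl; rewrite -[k]scale1r; apply: KL.
pose D := [set t | exists2 k, K k & t = nrm (x - k) ^+ 2].
have hD : has_inf D.
  split; first by exists (nrm (x - 0) ^+ 2), 0.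
  by exists 0 => _ [k _ ->]; apply: sqr_ge0.
pose d := inf D.
have d_le k : K k -> d <= nrm (x - k) ^+ 2.
  by move=> Kk; apply: ge_inf; [case: hD | exists k].
have near_inf n : exists k, K k /\ nrm (x - k) ^+ 2 < d + n.+1%:R^-1.
  have [|_ [k Kk ->] hk] := inf_adherent (_ : 0 < n.+1%:R^-1) hD.
    by rewrite invr_gt0.
  by exists k.
have [k /all_and2 [Kk kd]] := choice near_inf.
(* the parallelogram law makes a minimizing sequence Cauchy *)
have k_cauchy n m : (n <= m)%N ->
    nrm (k m - k n) <= Num.sqrt (4 * n.+1%:R^-1).
  move=> nm; rewrite -[leLHS]ger0_norm ?nrm_ge0 // -sqrtr_sqr ler_wsqrtr //.
  have mn : m.+1%:R^-1 <= n.+1%:R^-1 :> R by rewrite lef_pV2 ?posrE // ler_nat.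
  have h := d_le _ (KZ (2^-1)%:C%C _ (KD _ _ (Kk n) (Kk m))).
  have e1 : k m - k n = (x - k n) - (x - k m).
    by rewrite opprB [RHS]addrC subrKA.
  have e2 : (2^-1)%:C%C *: ((x - k n) + (x - k m)) =
      x - (2^-1)%:C%C *: (k n + k m).
    rewrite addrACA -opprD scalerBr; congr (_ - _).
    by rewrite -mulr2n -scalerMnr scalerMnl -rmorphMn -mulr_natr mulVf
      ?pnatr_eq0 ?scale1r.
  have := kd n; have := kd m; move: h; rewrite -e2 e1.
  move: (x - k n) (x - k m) => a b; rewrite nrmB_sqr nrmZ nrm_real exprMn.
  rewrite nrmD_sqr ger0_norm ?invr_ge0 // => h1 h2 h3.
  rewrite (_ : 2^-1 ^+ 2 = 4^-1) in h1; last by field.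
  move: h1 h2 h3 mn; move: m.+1%:R^-1 n.+1%:R^-1 => u v; lra.
have small e : 0 < e -> exists n, Num.sqrt (4 * n.+1%:R^-1) < e :> R.
  move=> e0; have [|n hn] := invS_small (_ : 0 < e ^+ 2 / 4).
    by rewrite divr_gt0 // exprn_gt0.
  exists n; rewrite -[ltRHS]ger0_norm ?ltW // -sqrtr_sqr ltr_sqrt ?exprn_gt0 //.
  by move: hn; move: n.+1%:R^-1 (e ^+ 2) => u v; lra.
have [p hp] := cauchy_limit k_cauchy small.
exists p => [|l Kl].
  apply/closureP_nrm => e /small [n hn]; exists (k n) => //.
  exact: le_lt_trans hn.
have p_min m : K m -> nrm (x - p) <= nrm ((x - p) - m).
  move=> Km; rewrite leNgt -subr_gt0; apply/negP => lt.
  (* Since [p] need not lie in [K], it is compared with [k n]. This costs three errors of at most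
     [e]: one in [h1], and one for each exchange of [p] and [k n]. *)
  have [|n] := small ((nrm (x - p) - nrm (x - p - m)) / 3).
    by rewrite divr_gt0.
  set e := Num.sqrt _ => he.
  have e0 : 0 <= e by apply: sqrtr_ge0.
  have h1 : nrm (x - k n) <= nrm (x - (k n + m)) + e.
    rewrite -ler_sqr ?nnegrE ?addr_ge0 ?nrm_ge0 //.
    have := d_le _ (KD _ _ (Kk n) Km); have := kd n.
    have : e ^+ 2 = 4 * n.+1%:R^-1 by rewrite sqr_sqrtr // mulr_ge0 ?invr_ge0.
    have : 0 <= nrm (x - (k n + m)) * e by rewrite mulr_ge0 ?nrm_ge0.
    have : 0 <= n.+1%:R^-1 :> R by rewrite invr_ge0.
    rewrite sqrrD; move: n.+1%:R^-1 => u; lra.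
  have h2 := nrm_triangle (k n) x p.
  have h3 : nrm (x - (k n + m)) <= nrm (x - p - m) + nrm (p - k n).
    rewrite (_ : x - (k n + m) = (x - p - m) + (p - k n)) ?nrmD //.
    by rewrite addrAC subrKA opprD addrA.
  by have := hp n; rewrite -/e (nrm_distC (k n)) in h2 *; lra.
apply: inner_ip0 => a; set m := a *: l.
have Km : K m by apply: KZ.
pose M := nrm m ^+ 2; pose c := ip m (x - p).
have M0 : 0 <= M by apply: sqr_ge0.
(* The best multiple of [m] would be [c / M]; the 1 avoids a zero denominator. Minimality then reads
   [2 * t * c <= t ^+ 2 * M] with [c = t * (M + 1)], which forces [t = 0]. *)
pose t := c / (M + 1).
have tE : t * (M + 1) = c by rewrite divfK // gt_eqF // ltr_wpDl.
have h := p_min _ (KZ t%:C%C _ Km).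
rewrite -ler_sqr ?nnegrE ?nrm_ge0 // (nrmB_sqr (x - p)) ipC ipZl
  nrmZ nrm_real in h.
rewrite exprMn real_normK ?num_real // -/M -/c in h.
apply/eqP; rewrite -/c -tE mulf_eq0; apply/orP; left.
rewrite -sqrf_eq0 eq_le sqr_ge0 andbT.
have := mulr_ge0 (sqr_ge0 t) M0; rewrite -tE in h.
by rewrite !expr2 in h *; lra.
Qed.

(** If [z] is orthogonal to the kernel of [f] and [f z] is nonzero, then [x - (f x / f z) *: z] lies
    in the kernel, which determines [f x] from the inner product with [z]. Such a [z] is the
    difference between a [w] outside the kernel and its projection; continuity gives [f p = 0]. *)
Lemma riesz X (f : X -> R[i]) M : scalar f ->
  (forall x, nrm (f x) <= M * nrm x) -> exists y, forall x, f x = '[x, y].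
Proof.
move=> lf fM.
have f0 : f 0 = 0.
  apply/eqP; rewrite -nrm_eq0 eq_le nrm_ge0 andbT.
  by rewrite (le_trans (fM 0)) ?nrm0 ?mulr0.
have fZ a x : f (a *: x) = a * f x by rewrite -[a *: x]addr0 lf f0 addr0.
have fB x y : f (x - y) = f x - f y.
  by rewrite addrC -scaleN1r lf mulN1r addrC.
have [fz|/existsNP [w /eqP fw]] := pselect (forall x, f x = 0).
  by exists 0 => x; rewrite fz inner0r.
have [|p clp hp] := @projection X [set x | f x = 0] w.
  by split=> //= a x y fx fy; rewrite lf fx fy mulr0 addr0.
have fp : f p = 0.
  apply/eqP; rewrite -nrm_eq0 eq_le nrm_ge0 andbT.
  have /closureP_nrm cl := clp.
  rewrite leNgt; apply/negP => fp.
  have [|k fk] := cl (nrm (f p) / (`|M| + 1)).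
    by rewrite divr_gt0 // ltr_wpDl.
  rewrite ltr_pdivlMr ?ltr_wpDl //; have := fM (p - k).
  rewrite fB (_ : f k = 0) // subr0; have := nrm_ge0 (p - k).
  move=> k0 h1 h2; have : M * nrm (p - k) <= `|M| * nrm (p - k).
    by rewrite ler_wpM2r // ler_norm.
  by lra.
pose z := w - p.
have fzE : f z = f w by rewrite fB fp subr0.
have z0 : z != 0 by apply: contraNneq fw => z0; rewrite -fzE z0 f0.
have zz : '[z, z] != 0.
  rewrite innerxx -(rmorph0 (@real_complex R)) (inj_eq (@complexI R)).
  by rewrite sqrf_eq0 nrm_eq0.
exists ((f z / '[z, z])^*%C *: z) => x.
have : '[x - (f x / f z) *: z, z] = 0.
  by apply: hp; rewrite /= fB fZ divfK ?subrr // fzE.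
rewrite innerBl innerZl => /eqP; rewrite subr_eq0 => /eqP xz.
rewrite innerZr conjcK xz; move: zz fw; rewrite -fzE => zz fz.
by field; rewrite zz fz.
Qed.

Lemma adjointE X Y (f : X -> Y) : bounded_operator f ->
  forall v y, '[f v, y] = '[v, adjoint f y].
Proof.
move=> /bounded_operatorP [lf [M M0 fM]] v y.
suff [x hx] : exists x, forall v, '[f v, y] = '[v, x].
  exact: (@xgetPex _ 0 [set x | forall v, '[f v, y] = '[v, x]]
    (ex_intro _ x hx)).
apply: (@riesz X (fun v => '[f v, y]) (M * nrm y)) => [a u w|u].
  by rewrite lf innerDl innerZl.
by rewrite (le_trans (cauchy_schwarz _ _)) // mulrAC ler_wpM2r ?nrm_ge0.
Qed.

(** Projecting [v] on the closed range of [T] gives [p] with [T p = T v], so the set behind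
    [pseudo_inverse] is nonempty. For any [q] in it the remainder [k = T (v - q)] lies both in the
    range and in the kernel of the selfadjoint [T], hence vanishes. *)
Lemma pseudo_inverseE X (T : X -> X) v : bounded_selfadjoint T ->
  T (pseudo_inverse T (T v)) = T v.
Proof.
move=> [[lT _] sT].
have T0 : T 0 = 0 by have := lT (-1) 0 0; rewrite scaler0 addr0 scaleN1r addNr.
have TB x y : T (x - y) = T x - T y by rewrite addrC -scaleN1r lT scaleN1r addrC.
have inner0 (x : X) : '[x, x] = 0 -> x = 0.
  by rewrite innerxx => /complexI /eqP; rewrite sqrf_eq0 nrm_eq0 => /eqP.
have [|p clp hp] := @projection X (range T) v.
  split=> [|a _ _ [x _ <-] [y _ <-]]; first by exists 0.
  by exists (a *: x + y); rewrite ?lT.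
have Tp : T v = T p.
  have : '[T (T (v - p)), v - p] = 0 by apply: hp; exists (T (v - p)).
  by rewrite sT => /inner0; rewrite TB => /eqP; rewrite subr_eq0 => /eqP.
have ex : exists x, closure (range T) x /\ exists2 k, T k = 0 & T v = T x + k.
  by exists p; split=> //; exists 0; rewrite // addr0.
have [_ [k Tk]] := xgetPex 0 ex; rewrite -/(pseudo_inverse T (T v)).
move: (pseudo_inverse _ _) => q Tq.
have kE : k = T (v - q) by rewrite TB {1}Tq addrAC subrr add0r.
by rewrite Tq (inner0 k) ?addr0 // {1}kE sT Tk inner0r.
Qed.

(** * Boundedness of a selfadjoint operator composed with a bounded one *)

Section Unbounded.
Variables (X : hilbertType R) (S : operator X).
Hypothesis selfS : selfadjoint S.

Lemma selfadjoint_sym x y : dom S x -> dom S y -> '[S x, y] = '[x, S y].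
Proof.
move=> Sx Sy; have : graph S (y, S y) by [].
by case: selfS => _ <-; apply.
Qed.

(* A nested ball argument: if [S \o B] were unbounded, the continuous
   functionals <S B u, y> = <B u, S y>, y in dom S, would allow for a point u
   at which |S (B u)| exceeds every integer. *)
Lemma selfadjoint_comp_bounded (U : hilbertType R) (B : U -> X) :
  bounded_operator B -> (forall u, dom S (B u)) -> bounded_operator (S \o B).
Proof.
move=> /bounded_operatorP [lB [M M0 BM]] SB.
have lSB : linear (S \o B) by move=> a u v; rewrite /= lB app_linear.
have SBB u v : S (B (u - v)) = S (B u) - S (B v).
  by have := lSB (-1) v u; rewrite /= !scaleN1r ![- _ + _]addrC.
have SBZ a u : S (B (a *: u)) = a *: S (B u).
  have SB0 : S (B 0) = 0 by have := SBB 0 0; rewrite !subrr.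
  by have := lSB a u 0; rewrite /= SB0 !addr0.
apply/bounded_operatorP; split=> //.
apply: contrapT => nb.
(* A bound [N] on a single ball of radius [r] would give the global bound [2 * N / r] by subtraction
   and scaling, contrary to [nb]. *)
have unb (u : U) (r N : R) : 0 < r ->
    exists2 v, nrm (v - u) <= r & N < nrm (S (B v)).
  move=> r0; apply: contrapT => h; apply: nb.
  have hN v : nrm (v - u) <= r -> nrm (S (B v)) <= N.
    by move=> vu; rewrite leNgt; apply/negP => hv; apply: h; exists v.
  have N0 : 0 <= N.
    by apply: le_trans (hN u _); rewrite ?nrm_ge0 // subrr nrm0 ltW.
  exists (2 * N / r) => [|v]; first by rewrite divr_ge0 ?mulr_ge0 // ltW.
  have [->|v0] := eqVneq v 0.
    by rewrite /= -(scale0r 0) SBZ !nrmZ !nrm0 !mul0r mulr0.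
  have vp : 0 < nrm v by rewrite nrm_gt0.
  pose t := (r / nrm v)%:C%C.
  have nt : nrm t = r / nrm v.
    by rewrite nrm_real ger0_norm // divr_ge0 ?ltW.
  have h1 : nrm (S (B (u + t *: v))) <= N.
    by apply: hN; rewrite addrC addKr nrmZ nt divfK ?gt_eqF.
  have h2 : nrm (S (B u)) <= N by apply: hN; rewrite subrr nrm0 ltW.
  have : nrm (S (B (t *: v))) <= 2 * N.
    rewrite -[t *: v](addKr u) addrC SBB.
    by rewrite (le_trans (nrmB _ _)) // mulr_natl mulr2n lerD.
  rewrite SBZ nrmZ nt -ler_pdivlMl ?divr_gt0 // invf_div.
  by rewrite (_ : nrm v / r * (2 * N) = 2 * N / r * nrm v) //; ring.
have step n (p : U * R) : 0 < p.2 -> exists q : U * R,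
    [/\ 0 < q.2, q.2 <= p.2 / 2, nrm (q.1 - p.1) <= p.2 / 2 &
    forall v, nrm (v - q.1) <= q.2 -> n%:R <= nrm (S (B v))].
  case: p => u r /= r0.
  have [|v vu hv] := unb u (r / 2) n%:R; first by rewrite divr_gt0.
  have [y Sy hy] : exists2 y, dom S y & n%:R * nrm y < nrm '[S (B v), y].
    apply: contrapT => h; move: hv; apply/negP; rewrite -leNgt.
    apply: (nrm_le_inner selfS.1) => // y Sy.
    by rewrite leNgt; apply/negP => hy; apply: h; exists y.
  pose K : R := M * nrm (S y) + 1.
  have K0 : 0 < K by rewrite ltr_wpDl // mulr_ge0 // nrm_ge0.
  have g0 : 0 < nrm '[S (B v), y] - n%:R * nrm y by rewrite subr_gt0.
  (* [K] is a Lipschitz constant of the functional defined by [y], with 1 added for positivity.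
     Within the second radius the functional loses at most its excess over [n%:R * nrm y] at [v]. *)
  exists (v, Num.min (r / 2) ((nrm '[S (B v), y] - n%:R * nrm y) / K)) => /=.
  split=> [||//|w]; first by rewrite lt_min !divr_gt0.
    by rewrite ge_min lexx.
  rewrite le_min => /andP[_]; rewrite ler_pdivlMr // => hw.
  have y0 : 0 < nrm y.
    rewrite nrm_gt0; apply: contraTneq hy => ->.
    by rewrite inner0r !nrm0 mulr0 ltxx.
  rewrite -(ler_pM2r y0); apply: le_trans (cauchy_schwarz _ _).
  have h1 : nrm '[S (B (w - v)), y] <= nrm (w - v) * K.
    rewrite selfadjoint_sym // (le_trans (cauchy_schwarz _ _)) //.
    have h1 : nrm (B (w - v)) * nrm (S y) <= M * nrm (w - v) * nrm (S y).
      by rewrite ler_wpM2r ?nrm_ge0.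
    by have := nrm_ge0 (w - v); rewrite /K; lra.
  have h2 : nrm '[S (B v), y] <= nrm '[S (B w), y] + nrm '[S (B (w - v)), y].
    by rewrite SBB innerBl -[X in nrm X <= _](subKr '[S (B w), y]) nrmB.
  by lra.
have [f hf] : exists f : nat -> U * R -> U * R, forall n p, 0 < p.2 ->
    [/\ 0 < (f n p).2, (f n p).2 <= p.2 / 2, nrm ((f n p).1 - p.1) <= p.2 / 2 &
    forall v, nrm (v - (f n p).1) <= (f n p).2 -> n%:R <= nrm (S (B v))].
  have /choice [f hf] : forall np : nat * (U * R), exists q : U * R,
    0 < np.2.2 -> [/\ 0 < q.2, q.2 <= np.2.2 / 2,
      nrm (q.1 - np.2.1) <= np.2.2 / 2 &
      forall v, nrm (v - q.1) <= q.2 -> np.1%:R <= nrm (S (B v))].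
    move=> [n p] /=; have [p0|p0] := ltP 0 p.2; last first.
      by exists p.
    by have [q hq] := step n p p0; exists q.
  by exists (fun n p => f (n, p)) => n p; apply: (hf (n, p)).
pose s := fix s n := if n is n'.+1 then f n' (s n') else (0 : U, 1 : R).
have s0 n : 0 < (s n).2.
  by elim: n => [|n IH] //=; have [] := hf n _ IH.
have s_half n : (s n).2 <= 1 * 2^-1 ^+ n.
  elim: n => [|n IH]; first by rewrite expr0 mulr1.
  have [_ h _ _] := hf n _ (s0 n); rewrite exprS /=.
  by apply: (le_trans h); lra.
(* Each step moves the center by at most half the radius and at least halves the radius, so the
   balls are nested and the limit of the centers lies in all of them. *)
have nest n m : (n <= m)%N -> nrm ((s m).1 - (s n).1) <= (s n).2 - (s m).2.
  move=> nm; rewrite -(subnK nm); elim: (m - n)%N => [|k IH].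
    by rewrite !subrr nrm0.
  rewrite addSn /=; have [_ h1 h2 _] := hf (k + n)%N _ (s0 (k + n)%N).
  have := nrm_triangle (s (k + n)%N).1 (f (k + n)%N (s (k + n)%N)).1 (s n).1.
  by lra.
have [||l hl] := @cauchy_limit R U (fun n => (s n).1) (fun n => (s n).2).
- by move=> n m nm; rewrite (le_trans (nest _ _ nm)) // gerBl ltW.
- move=> d d0; have [|n hn] := @geometric_small R 2^-1 1 d _ d0.
    by rewrite invr_ge0 ler0n /= invf_lt1 // ltr1n.
  by exists n; rewrite (le_lt_trans (s_half n)).
(* [n] strictly exceeds the norm at [l], yet [l] lies in the ball of index [n.+1], on which the norm
   is at least [n]. *)
pose n := Num.bound (nrm (S (B l))).
have [_ _ _ h] := hf n _ (s0 n).
by have := h l (hl n.+1); rewrite leNgt archi_boundP // nrm_ge0.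
Qed.

End Unbounded.

End InnerProduct.

(** * Operator power series *)

Section PowerSeries.
Variable R : realType.
Implicit Types X Y : hilbertType R.

Lemma iter_linear X (A : {linear X -> X}) n : linear (iter n A).
Proof. by elim: n => [|n IH] a x y //=; rewrite IH linearP. Qed.

(** With [K x = M / (1 - a) * nrm x], the k-th term is at most [K x * a ^+ k - K x * a ^+ k.+1], and
    these bounds telescope. The case [n = 0] of the conclusion is the boundedness of [V]. *)
Lemma operator_series X Y (T : nat -> X -> Y) (M a : R) :
  (forall n, linear (T n)) -> 0 <= M -> 0 <= a < 1 ->
  (forall n x, nrm (T n x) <= M * a ^+ n * nrm x) ->
  exists2 V : X -> Y, linear V & forall n x,
    nrm (V x - \sum_(0 <= k < n) T k x) <= M / (1 - a) * nrm x * a ^+ n.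
Proof.
move=> lT M0 a01 TM; have /andP[a0 a1] := a01.
have d0 : 0 < 1 - a by rewrite subr_gt0.
pose s n x := \sum_(0 <= k < n) T k x.
have ls n : linear (s n).
  move=> c x y; rewrite /s scaler_sumr -big_split /=.
  by apply: eq_bigr => k _; rewrite lT.
pose K (x : X) : R := M / (1 - a) * nrm x.
have K0 x : 0 <= K x by rewrite mulr_ge0 ?divr_ge0 ?nrm_ge0 // ltW.
have KE x : K x * (1 - a) = M * nrm x by rewrite mulrAC divfK // gt_eqF.
have s_diff x n j :
    nrm (s (j + n)%N x - s n x) <= K x * a ^+ n - K x * a ^+ (j + n).
  elim: j => [|j IH]; first by rewrite !subrr nrm0.
  rewrite addSn {1}/s big_nat_recr //= -/(s (j + n)%N x) addrAC.
  apply: (le_trans (nrmD _ _)); have := TM (j + n)%N x; rewrite exprS.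
  have : M * a ^+ (j + n) * nrm x = K x * (1 - a) * a ^+ (j + n).
    by rewrite KE mulrAC.
  by lra.
have lim x : exists l, forall n, nrm (l - s n x) <= K x * a ^+ n.
  apply: cauchy_limit => [n m nm|e e0]; last exact: geometric_small.
  rewrite -(subnK nm) (le_trans (s_diff _ _ _)) // gerBl.
  by rewrite mulr_ge0 ?exprn_ge0.
have [V hV] := choice lim.
exists V => [c x y|n x]; last exact: hV.
apply/eqP; rewrite -subr_eq0; apply/eqP.
apply: (eq0_geometric (K := K (c *: x + y) + nrm c * K x + K y) a01) => n.
have -> : V (c *: x + y) - (c *: V x + V y) =
    (V (c *: x + y) - s n (c *: x + y)) - c *: (V x - s n x) - (V y - s n y).
  rewrite ls scalerBr.
  by rewrite -[RHS]addrA -opprD addrACA -opprD opprB addrA subrK.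
apply: (le_trans (nrmB _ _)).
have h1 := nrmB (V (c *: x + y) - s n (c *: x + y)) (c *: (V x - s n x)).
have h2 : nrm (c *: (V x - s n x)) <= nrm c * (K x * a ^+ n).
  by rewrite nrmZ ler_wpM2l // nrm_ge0.
by have := hV y n; have := hV (c *: x + y) n; lra.
Qed.

Lemma neumann_series X (A : {linear X -> X}) (M : R) (l : R[i]) :
  0 <= M -> (forall x, nrm (A x) <= M * nrm x) -> nrm l * M < 1 ->
  exists V : X -> X, [/\ bounded_operator V,
    cancel (fun x => x - l *: A x) V, cancel V (fun x => x - l *: A x) &
    forall n x, nrm (V x - \sum_(0 <= k < n) l ^+ k *: iter k A x) <=
      (1 - nrm l * M)^-1 * nrm x * (nrm l * M) ^+ n].
Proof.
move=> M0 AM lM; set a := nrm l * M.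
have a0 : 0 <= a by rewrite mulr_ge0 ?nrm_ge0.
have a01 : 0 <= a < 1 by rewrite a0.
have iterM n x : nrm (l ^+ n *: iter n A x) <= a ^+ n * nrm x.
  rewrite nrmZ nrmX /a exprMn -mulrA ler_wpM2l ?exprn_ge0 ?nrm_ge0 //.
  elim: n => [|n IH]; first by rewrite expr0 mul1r.
  by rewrite exprS -mulrA (le_trans (AM _)) // ler_wpM2l.
have [||n x|V lV hV] := @operator_series X X
    (fun n x => l ^+ n *: iter n A x) 1 a _ _ a01 => //.
- by move=> n c x y; rewrite iter_linear scalerDr !scalerA [_ * c]mulrC.
- by rewrite mul1r.
pose pen x := x - l *: A x.
pose s n x := \sum_(0 <= k < n) l ^+ k *: iter k A x.
have iter_pen n x : iter n A (pen x) = iter n A x - l *: iter n.+1 A x.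
  by rewrite iterSr /pen -[x - _]addrC -scaleNr iter_linear scaleNr addrC.
(* Telescoping on either side of [pen] leaves the same geometrically small term, which makes [V] a
   two-sided inverse. *)
have s_pen n x : s n (pen x) = x - l ^+ n *: iter n A x.
  elim: n => [|n IH]; first by rewrite /s big_nil expr0 scale1r subrr.
  rewrite /s big_nat_recr //= -/(s n _) IH iter_pen.
  by rewrite scalerBr subrKA scalerA -exprSr.
have pen_s n x : pen (s n x) = x - l ^+ n *: iter n A x.
  elim: n => [|n IH].
    by rewrite /pen /s big_nil linear0 scaler0 expr0 scale1r !subrr.
  rewrite {1}/s big_nat_recr //= -/(s n _) /pen linearD scalerDr opprD addrACA.
  rewrite -/(pen _) IH subrKA [A _]linearZ /=.
  by rewrite scalerA -exprS.
rewrite mul1r in hV *.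
have V_bd x : nrm (V x) <= (1 - a)^-1 * nrm x.
  by have := hV 0%N x; rewrite big_nil subr0 expr0 mulr1.
exists V; split; last exact: hV.
- apply/bounded_operatorP; split=> //; exists (1 - a)^-1 => //.
  by rewrite invr_ge0 subr_ge0 ltW.
- move=> x; apply/eqP; rewrite -subr_eq0; apply/eqP.
  apply: (eq0_geometric (K := (1 - a)^-1 * nrm (pen x) + nrm x) a01) => n.
  rewrite -/(pen x).
  rewrite (_ : _ - x = (V (pen x) - s n (pen x)) - l ^+ n *: iter n A x).
    apply: (le_trans (nrmB _ _)); rewrite mulrDl.
    by apply: lerD; [exact: hV | rewrite mulrC].
  by rewrite s_pen opprB [in RHS]addrA [RHS]addrAC addrK.
- move=> x; rewrite -/(pen (V x)); apply/eqP; rewrite -subr_eq0; apply/eqP.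
  apply: (eq0_geometric (K := (1 + a) * ((1 - a)^-1 * nrm x) + nrm x) a01) => n.
  have -> : pen (V x) - x = pen (V x - s n x) - l ^+ n *: iter n A x.
    rewrite (_ : pen (V x - s n x) = pen (V x) - pen (s n x)).
      by rewrite pen_s opprB [in RHS]addrA [RHS]addrAC addrK.
    by rewrite /pen [A (_ - _)]linearB scalerBr !opprD addrACA.
  apply: (le_trans (nrmB _ _)).
  rewrite mulrDl; apply: lerD; last by rewrite mulrC.
  apply: (le_trans (nrmB _ _)); rewrite mulrDl mul1r mulrDl.
  apply: lerD; first exact: hV.
  rewrite nrmZ -mulrA /a -mulrA ler_wpM2l ?nrm_ge0 //.
  by rewrite (le_trans (AM _)) // ler_wpM2l // hV.
Qed.

(** The comparison term [b m] is the second-order Taylor remainder of the real power at [r] with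
    increment [s]. The complex remainder obeys the same recursion with [h ^+ 2] in place of
    [s ^+ 2], whence the factor [q ^+ 2], uniform in the exponent. *)
Lemma power_remainder (z h : R[i]) (s : R) n : 0 < s -> nrm h <= s ->
  nrm ((z + h) ^+ n - z ^+ n - h * (n%:R * z ^+ n.-1)) <=
    (nrm h / s) ^+ 2 * (nrm z + s) ^+ n /\
  nrm (n%:R * z ^+ n.-1) <= s^-1 * (nrm z + s) ^+ n.
Proof.
move=> s0 hs; set r := nrm z; set q := nrm h / s.
have r0 : 0 <= r by apply: nrm_ge0.
pose d m : R[i] := m%:R * z ^+ m.-1.
pose e m : R := m%:R * r ^+ m.-1.
have e0 m : 0 <= e m by rewrite mulr_ge0 ?exprn_ge0.
have de m : nrm (d m) = e m by rewrite nrmM nrm_nat nrmX.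
have dS m : d m.+1 = z * d m + z ^+ m.
  by rewrite /d; case: m => [|m] /=; rewrite ?exprS; ring.
have eS m : e m.+1 = r * e m + r ^+ m.
  by rewrite /e; case: m => [|m] /=; rewrite ?exprS; ring.
pose b m : R := (r + s) ^+ m - r ^+ m - s * e m.
have bS m : b m.+1 = (r + s) * b m + s ^+ 2 * e m.
  by rewrite /b eS !exprS; ring.
have b0 m : 0 <= b m.
  elim: m => [|m IH]; first by rewrite /b /e !expr0 mul0r mulr0 subrr subr0.
  by rewrite bS addr_ge0 // mulr_ge0 ?sqr_ge0 // addr_ge0 // ltW.
have b_le m : b m <= (r + s) ^+ m.
  by have := exprn_ge0 m r0; have := mulr_ge0 (ltW s0) (e0 m); rewrite /b; lra.
split; last first.
  rewrite -/(d n) de -ler_pdivrMl ?invr_gt0 // invrK.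
  by have := exprn_ge0 n r0; have := b0 n; rewrite /b; lra.
apply: (le_trans _ (ler_wpM2l (sqr_ge0 q) (b_le n))).
rewrite -/(d n); elim: n => [|n IH].
  by rewrite !expr0 subrr /d mul0r mulr0 subr0 nrm0 mulr_ge0 ?sqr_ge0.
have -> : (z + h) ^+ n.+1 - z ^+ n.+1 - h * d n.+1 =
    (z + h) * ((z + h) ^+ n - z ^+ n - h * d n) + h ^+ 2 * d n.
  by rewrite dS !exprS; ring.
apply: (le_trans (nrmD _ _)).
rewrite (nrmM (z + h)) (nrmM (h ^+ 2)) nrmX de bS mulrDr lerD //.
  by rewrite [leRHS]mulrCA ler_pM ?nrm_ge0 // (le_trans (nrmD _ _)) // lerD.
by rewrite [leRHS]mulrA -exprMn divfK ?gt_eqF.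
Qed.

(* By [power_remainder] the n-th terms of the formal derivative and of the
   difference quotients are all O(rho ^+ n) for one rho < 1, so that a single
   geometric series controls them. *)
Lemma operator_power_series_differentiable X Y (c : nat -> X -> Y)
    (f : R[i] -> X -> Y) :
  (forall n, linear (c n)) -> (forall n x, nrm (c n x) <= nrm x) ->
  (forall z, nrm z < 1 -> forall n x,
    nrm (f z x - \sum_(0 <= k < n) z ^+ k *: c k x) <=
      (1 - nrm z)^-1 * nrm x * nrm z ^+ n) ->
  forall z, nrm z < 1 -> op_differentiable_at f z.
Proof.
move=> lc c1 fE z z1.
have [s s0 rho1] : exists2 s, 0 < s & nrm z + s < 1.
  by exists ((1 - nrm z) / 2); lra.
pose rho : R := nrm z + s.
rewrite -/rho in rho1.
have z0 := nrm_ge0 z.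
have rho0 : 0 <= rho by rewrite addr_ge0 // ltW.
have d0 : 0 < 1 - rho by rewrite subr_gt0.
have [||||L lL hL] := @operator_series X Y
    (fun n x => (n%:R * z ^+ n.-1) *: c n x) s^-1 rho => //.
- by move=> n a x y; rewrite lc scalerDr !scalerA [_ * a]mulrC.
- by rewrite invr_ge0 ltW.
- by rewrite rho0.
- move=> n x; rewrite nrmZ ler_pM ?nrm_ge0 //.
  by have [] := @power_remainder z 0 s n s0; rewrite ?nrm0 // ltW.
exists L.
  apply/bounded_operatorP; split=> //; exists (s^-1 / (1 - rho)).
    by rewrite divr_ge0 ?invr_ge0 // ltW.
  by move=> x; have := hL 0%N x; rewrite big_nil subr0 expr0 mulr1.
move=> e e0; have er : e = (complex.Re e)%:C%C by rewrite RRe_real // gtr0_real.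
move: e0; rewrite er ltcR; move: (complex.Re e) => {er} {}e e0.
(* The remainders of the powers sum to at most [(nrm h / s) ^+ 2 / (1 - rho) * nrm x]. The second
   entry bounds this by [nrm h * (e * nrm x)]; the first keeps [nrm (z + h)] below [rho]. *)
pose m : R := Num.min s (e * s ^+ 2 * (1 - rho)).
exists m%:C%C => [|h]; first by rewrite ltcR lt_min s0 /= !mulr_gt0.
rewrite nrmE !ltcR lt_min => h0 /andP[hs he] x.
rewrite !nrmE -rmorphM lecR -(ler_pM2l h0) -nrmZ.
have hn0 : h != 0 by rewrite -nrm_gt0.
rewrite scalerBr scalerA divff // scale1r.
have zh : nrm (z + h) <= rho by rewrite (le_trans (nrmD _ _)) // lerD2l ltW.
have zh1 := le_lt_trans zh rho1.
have inv_le t : t <= rho -> (1 - t)^-1 <= (1 - rho)^-1.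
  move=> tr; have := d0; have : 0 < 1 - t by lra.
  by move=> t1 ?; rewrite lef_pV2 ?posrE //; lra.
have tail t n : nrm t <= rho ->
    nrm (f t x - \sum_(0 <= k < n) t ^+ k *: c k x) <=
    (1 - rho)^-1 * nrm x * rho ^+ n.
  move=> tr; apply: (le_trans (fE t _ n x)); first exact: le_lt_trans rho1.
  rewrite ler_pM ?mulr_ge0 ?invr_ge0 ?exprn_ge0 ?nrm_ge0 ?subr_ge0 //.
  - by rewrite (le_trans tr) // ltW.
  - by rewrite ler_wpM2r ?nrm_ge0 // inv_le.
  - by rewrite lerXn2r ?nnegrE ?nrm_ge0.
have rho01 : 0 <= rho < 1 by rewrite rho0.
(* [K] collects the truncation errors of the two values of [f] and of [h *: L x]. *)
pose K := (2 * (1 - rho)^-1 + nrm h * (s^-1 / (1 - rho))) * nrm x.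
apply: (le_geometric (K := K) rho01) => n; rewrite /K.
set S1 := \sum_(0 <= k < n) (z + h) ^+ k *: c k x.
set S2 := \sum_(0 <= k < n) z ^+ k *: c k x.
set S3 := \sum_(0 <= k < n) (k%:R * z ^+ k.-1) *: c k x.
have -> : f (z + h) x - f z x - h *: L x =
    (S1 - S2 - h *: S3) + ((f (z + h) x - S1) - (f z x - S2) - h *: (L x - S3)).
  rewrite scalerBr !opprB addrACA addKr addrACA addKr.
  by rewrite [S1 + _]addrC subrK.
have h1 : nrm (S1 - S2 - h *: S3) <= nrm h * (e * nrm x).
  rewrite /S1 /S2 /S3 scaler_sumr -!sumrB.
  pose G k := (nrm h / s) ^+ 2 * nrm x * rho ^+ k.
  apply: (le_trans (y := \sum_(0 <= k < n) G k)).
    apply: nrm_sum => k; rewrite scalerA -!scalerBl nrmZ /G.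
    rewrite [leRHS]mulrAC ler_pM ?nrm_ge0 //.
    by have [] := @power_remainder z h s k s0 (ltW hs).
  rewrite /G -mulr_sumr.
  have := sum_geometric_le n rho01.
  rewrite -(ler_pM2l (_ : 0 < (nrm h / s) ^+ 2)) ?exprn_gt0 ?divr_gt0 // => hG.
  rewrite mulrAC mulrA ler_wpM2r ?nrm_ge0 //; apply: (le_trans hG).
  rewrite ler_pdivrMr // exprMn exprVn ler_pdivrMr ?exprn_gt0 //.
  rewrite (expr2 (nrm h)) -!mulrA ler_pM2l // ltW //.
  by rewrite [X in _ < _ * X]mulrC mulrA.
apply: (le_trans (nrmD _ _)); apply: lerD => //.
apply: (le_trans (nrmB _ _)); rewrite nrmZ.
have h2 := nrmB (f (z + h) x - S1) (f z x - S2).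
have h3 : nrm h * nrm (L x - S3) <=
    nrm h * (s^-1 / (1 - rho) * nrm x * rho ^+ n).
  by rewrite ler_wpM2l ?nrm_ge0 // hL.
have h4 := tail _ n zh; have h5 := tail z n.
rewrite /rho lerDl ltW // -/rho in h5.
by have := h5 isT; rewrite -/S1 -/S2 in h4 *; lra.
Qed.

End PowerSeries.

(** * Dissipation inequality and contractivity *)

Section Dissipation.
Variables (R : realType) (X U Y : hilbertType R) (Sigma : linear_system X U Y).

Local Notation A := (sysA Sigma).
Local Notation B := (sysB Sigma).
Local Notation C := (sysC Sigma).
Local Notation D := (sysD Sigma).

(** The right side minus the left side is the square of the norm of [w - T u], where [w] is the
    pseudo-inverse image of [cross S x]. The range condition gives [T w = cross S x], which turns
    [ip w (T u)] into the mixed terms. *)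
Lemma riccati_dissipation (H : operator X) :
  generalized_riccati_solution Sigma H ->
  exists S : operator X,
    [/\ forall x, dom S x -> dom S (A x), forall u, dom S (B u) &
      forall x u, dom S x ->
        nrm (S (A x + B u)) ^+ 2 + nrm (C x + D u) ^+ 2 <=
        nrm (S x) ^+ 2 + nrm u ^+ 2].
Proof.
move=> [_ _ [S [selfS _ _ _] [SA SB _ _ [T [sT _ dT] [cT req]]]]].
exists S; split=> // x u Sx.
have adjSB := adjointE (selfadjoint_comp_bounded selfS (sysB_bounded Sigma) SB).
have adjD := adjointE (sysD_bounded Sigma).
have [v _ Tv] := cT _ Sx.
have := req _ Sx; rewrite -Tv; set w := pseudo_inverse T (T v).
have Tw : T w = cross Sigma S x by rewrite pseudo_inverseE.
rewrite !nrmE -!rmorphXn -!rmorphB /= => /complexI eqw.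
have Sxu : S (A x + B u) = S (A x) + S (B u).
  by rewrite -[A x]scale1r app_linear ?scale1r //; apply: SA.
have ip_cross : ip w (T u) = ip (S (A x)) (S (B u)) + ip (C x) (D u).
  rewrite {1}/ip -sT.2 -/(ip _ _) Tw /cross ipDl.
  rewrite ![ip (adjoint _ _) _]ipC /ip -adjD -adjSB /=.
  by rewrite -!/(ip _ _) addrC ipC [ip (D _) _]ipC.
have ip_delta :
    nrm (T u) ^+ 2 = nrm u ^+ 2 - nrm (D u) ^+ 2 - nrm (S (B u)) ^+ 2.
  rewrite -!ipxx {1}/ip sT.2 -dT -/(ip _ _) /delta !ipDr !ipNr.
  by rewrite {2 3}/ip -adjD -adjSB.
have := sqr_ge0 (nrm (w - T u)).
by rewrite nrmB_sqr Sxu !nrmD_sqr ip_cross ip_delta -eqw; lra.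
Qed.

(** The Markov parameters, that is, the impulse response of the system. *)
Definition markov (n : nat) (u : U) : Y :=
  if n is k.+1 then C (iter k A (B u)) else D u.

Lemma markov_linear n : linear (markov n).
Proof.
by case: n => [|n] a u v /=; rewrite ?linearP // iter_linear linearP.
Qed.

Section Storage.
Variable S : operator X.
Hypothesis SA : forall x, dom S x -> dom S (A x).
Hypothesis SB : forall u, dom S (B u).
Hypothesis dissip : forall x u, dom S x ->
  nrm (S (A x + B u)) ^+ 2 + nrm (C x + D u) ^+ 2 <=
  nrm (S x) ^+ 2 + nrm u ^+ 2.

Lemma domZ a x : dom S x -> dom S (a *: x).
Proof.
by move=> Sx; rewrite -[_ *: _]addr0; apply: dom_linear => //; apply: dom0.
Qed.

Lemma app0 : S 0 = 0.
Proof.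
have := @app_linear _ _ S (-1) 0 0 (dom0 S) (dom0 S).
by rewrite scaler0 addr0 scaleN1r addNr.
Qed.

Lemma appZ a x : dom S x -> S (a *: x) = a *: S x.
Proof.
move=> Sx; rewrite -[a *: x]addr0 app_linear ?app0 ?addr0 //; exact: dom0.
Qed.

(** With input [u] at time 0 and zero input afterwards, the storage never exceeds [nrm u ^+ 2], and
    each output is paid for by the storage it consumes. *)
Lemma markov_contractive n u : nrm (markov n u) <= nrm u.
Proof.
have h0 : nrm (S (B u)) ^+ 2 + nrm (D u) ^+ 2 <= nrm u ^+ 2.
  have := dissip u (dom0 S).
  by rewrite !linear0 !add0r app0 nrm0 expr0n /= add0r.
have hA x : dom S x -> nrm (S (A x)) ^+ 2 + nrm (C x) ^+ 2 <= nrm (S x) ^+ 2.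
  by move=> /(dissip 0); rewrite !linear0 !addr0 nrm0 expr0n /= addr0.
have dI k : dom S (iter k A (B u)) by elim: k => //= k; apply: SA.
have hI k : nrm (S (iter k A (B u))) ^+ 2 <= nrm u ^+ 2.
  elim: k => [|k IH] /=; first by have := sqr_ge0 (nrm (D u)); lra.
  by have := hA _ (dI k); have := sqr_ge0 (nrm (C (iter k A (B u)))); lra.
rewrite -ler_sqr ?nnegrE ?nrm_ge0 //; case: n => [|n] /=.
  by have := sqr_ge0 (nrm (S (B u))); lra.
have := hA _ (dI n); have := hI n.
by have := sqr_ge0 (nrm (S (A (iter n A (B u))))); lra.
Qed.

(* With [g n = \sum_(k < n) z ^+ k.+1 *: A ^ k B u] the partial sums are the
   outputs [C (g n) + D u], while [g n.+1 = z *: (A (g n) + B u)]. If they stayed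
   longer than the input [u], the storage [nrm (S (g n)) ^+ 2] would decrease
   by a fixed amount at each step. *)
Lemma markov_series_contractive (z : R[i]) u y K : nrm z < 1 ->
  (forall n,
    nrm (y - \sum_(0 <= k < n) z ^+ k *: markov k u) <= K * nrm z ^+ n) ->
  nrm y <= nrm u.
Proof.
move=> z1 hy; rewrite leNgt; apply/negP => uy.
have z0 := nrm_ge0 z; have z01 : 0 <= nrm z < 1 by rewrite z0.
have K0 : 0 <= K.
  by have := hy 0%N; rewrite expr0 mulr1; apply: le_trans; apply: nrm_ge0.
(* For nonzero [z], this is [z ^+ n] times the state reached from 0 at time n under the inputs
   [z ^- k *: u]. *)
pose g n : X := \sum_(0 <= k < n) z ^+ k.+1 *: iter k A (B u).
have gS n : g n.+1 = z *: (A (g n) + B u).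
  rewrite /g big_nat_recl //= expr1 addrC scalerDr linear_sum scaler_sumr.
  by congr (_ + _); apply: eq_bigr => k _; rewrite linearZ /= scalerA -exprS.
have gC n : \sum_(0 <= k < n.+1) z ^+ k *: markov k u = C (g n) + D u.
  rewrite big_nat_recl //= expr0 scale1r addrC linear_sum.
  by congr (_ + _); apply: eq_bigr => k _; rewrite linearZ.
have dAB x : dom S x -> dom S (A x + B u).
  by move=> Sx; rewrite -[A _]scale1r; apply: dom_linear => //; apply: SA.
have dg n : dom S (g n).
  elim: n => [|n IH]; first by rewrite /g big_nil; apply: dom0.
  by rewrite gS; apply: domZ; apply: dAB.
(* Half of the gap absorbs the truncation error; the other half remains as the excess of the outputs
   over [nrm u]. *)
pose e := (nrm y - nrm u) / 2.
have [|N hN] := @geometric_small R (nrm z) K e z01.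
  by rewrite divr_gt0 ?subr_gt0.
pose V n := nrm (S (g n)) ^+ 2.
pose d := (nrm u + e) ^+ 2 - nrm u ^+ 2.
have e0 : 0 < e by rewrite divr_gt0 ?subr_gt0.
have u0 := nrm_ge0 u.
have d0 : 0 < d.
  rewrite /d sqrrD.
  by have := mulr_ge0 u0 (ltW e0); have := exprn_gt0 2 e0; lra.
have V_decr n : (N <= n)%N -> V n.+1 <= V n - d.
  move=> Nn; have := dissip u (dg n).
  have out : nrm u + e <= nrm (C (g n) + D u).
    have h1 := hy n.+1; rewrite gC in h1.
    have h2 : nrm z ^+ n.+1 <= nrm z ^+ N.
      by apply: ler_wiXn2l => //; [exact: ltW | exact: leqW].
    have h3 : K * nrm z ^+ n.+1 <= K * nrm z ^+ N by rewrite ler_wpM2l.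
    have h4 := nrmD (y - (C (g n) + D u)) (C (g n) + D u).
    by rewrite subrK in h4; rewrite /e in hN *; lra.
  have : (nrm u + e) ^+ 2 <= nrm (C (g n) + D u) ^+ 2.
    by rewrite ler_sqr ?nnegrE ?nrm_ge0 // addr_ge0 // ltW.
  have : V n.+1 <= nrm (S (A (g n) + B u)) ^+ 2.
    rewrite /V gS appZ; last exact: dAB.
    by rewrite nrmZ exprMn ler_piMl ?sqr_ge0 // exprn_ile1 // ltW.
  by rewrite -/(V n) /d; lra.
have V_lin j : V (j + N)%N <= V N - j%:R * d.
  elim: j => [|j IH]; first by rewrite mul0r subr0.
  by have := V_decr (j + N)%N (leq_addl _ _); rewrite addSn -natr1; lra.
(* This [j] satisfies [V N + 1 < j.+1%:R * d], so after [j.+1] further steps the storage would be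
   negative. *)
have [|j] := @invS_small R (d / (V N + 1)).
  by rewrite divr_gt0 // ltr_wpDl // sqr_ge0.
have VN : 0 < V N + 1 by rewrite ltr_wpDl // sqr_ge0.
rewrite ltr_pdivlMr // mulrC ltr_pdivrMr // => hj.
by have := V_lin j.+1; have : 0 <= V (j.+1 + N)%N := sqr_ge0 _; lra.
Qed.

End Storage.

End Dissipation.

(** * The Schur class function and its agreement with the transfer function *)

Theorem theorem1p2 (R : realType) (X U Y : hilbertType R)
  (sepX : separable X) (sepU : separable U) (sepY : separable Y)
  (Sigma : linear_system X U Y) (minSigma : minimal Sigma)
  (RE_nonempty : riccati_solutions Sigma !=set0) :
  exists2 theta : R[i] -> U -> Y, schur_class theta &
    exists2 r : R[i], 0 < r &
      forall l : R[i], `|l| < r ->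
        transfer_dom Sigma l /\ transfer Sigma l =1 theta l.
Proof.
have [H /riccati_dissipation [S [SA SB dissip]]] := RE_nonempty.
have mc := markov_contractive SA SB dissip.
have [theta thetaP] : exists theta : R[i] -> U -> Y, forall z, nrm z < 1 ->
    linear (theta z) /\ forall n u,
      nrm (theta z u - \sum_(0 <= k < n) z ^+ k *: markov Sigma k u) <=
      (1 - nrm z)^-1 * nrm u * nrm z ^+ n.
  suff /choice [f hf] : forall z : R[i], exists V : U -> Y, nrm z < 1 ->
      linear V /\ forall n u,
      nrm (V u - \sum_(0 <= k < n) z ^+ k *: markov Sigma k u) <=
      (1 - nrm z)^-1 * nrm u * nrm z ^+ n by exists f.
  move=> z.
  have [z1|] := ltP (nrm z) 1; last by exists (fun=> 0).
  have [||||V lV hV] := @operator_series R U Y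
      (fun k u => z ^+ k *: markov Sigma k u) 1 (nrm z) => //.
  - by move=> n c u v; rewrite markov_linear scalerDr !scalerA [_ * c]mulrC.
  - by rewrite nrm_ge0.
  - move=> n u; rewrite nrmZ nrmX mul1r ler_wpM2l ?exprn_ge0 ?nrm_ge0 //.
  by exists V => _; split=> // n u; have := hV n u; rewrite mul1r.
exists theta.
  move=> z; rewrite nrmE ltcR => z1; have [ltheta htheta] := thetaP z z1.
  have contr u : nrm (theta z u) <= nrm u.
    exact: (markov_series_contractive SA SB dissip z1 (htheta^~ u)).
  split.
  - by apply/bounded_operatorP; split=> //; exists 1 => // u; rewrite mul1r.
  - apply: (operator_power_series_differentiable (markov_linear Sigma) mc) => //.
    by move=> t t1; apply: (thetaP t t1).2.
  - by move=> u; rewrite mul1r ler_nrm.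
have [lA [MA MA0 hMA]] := (bounded_operatorP _).1 (sysA_bounded Sigma).
have [lC [MC MC0 hMC]] := (bounded_operatorP _).1 (sysC_bounded Sigma).
have MA1 : 0 < MA + 1 by rewrite ltr_wpDl.
(* Below this radius [nrm l * MA + nrm l < 1], which serves the Neumann series and the disc at once;
   this sum is also the common rate [b] below. *)
exists ((MA + 1)^-1)%:C%C => [|l]; first by rewrite ltcR invr_gt0.
rewrite nrmE ltcR -[X in _ < X]mul1r ltr_pdivlMr // mulrDr mulr1 => hl.
have l0 := nrm_ge0 l.
have lMA0 : 0 <= nrm l * MA by rewrite mulr_ge0.
have lMA : nrm l * MA < 1 by lra.
have l1 : nrm l < 1 by lra.
have [V [bV VK KV hV]] := neumann_series MA0 hMA lMA.
split=> [|u]; first by exists V.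
have invE : inverse (pencil Sigma l) (sysB Sigma u) = V (sysB Sigma u).
  have ex : exists x, pencil Sigma l x = sysB Sigma u.
    by exists (V (sysB Sigma u)); apply: KV.
  by rewrite -[LHS]VK; congr V; apply: (xgetPex 0 ex).
rewrite /transfer invE; set x := sysB Sigma u.
apply/esym/eqP; rewrite -subr_eq0; apply/eqP.
pose b := nrm l * MA + nrm l.
have b01 : 0 <= b < 1 by rewrite addr_ge0.
pose K1 := (1 - nrm l)^-1 * nrm u.
pose K2 := nrm l * (MC * ((1 - nrm l * MA)^-1 * nrm x)).
have K10 : 0 <= K1 by rewrite mulr_ge0 ?nrm_ge0 // invr_ge0 subr_ge0 ltW.
have K20 : 0 <= K2.
  by rewrite !mulr_ge0 ?nrm_ge0 // invr_ge0 subr_ge0 ltW.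
apply: (eq0_geometric (K := K1 + K2) b01) => n.
pose t := \sum_(0 <= k < n) l ^+ k *: iter k (sysA Sigma) x.
(* The feedthrough [D] takes index 0, so [n.+1] Markov terms match [n] Neumann terms. *)
have sE : \sum_(0 <= k < n.+1) l ^+ k *: markov Sigma k u =
    sysD Sigma u + l *: sysC Sigma t.
  rewrite big_nat_recl //= expr0 scale1r linear_sum scaler_sumr.
  by congr (_ + _); apply: eq_bigr => k _; rewrite linearZ /= scalerA -exprS.
have h1 := (thetaP l l1).2 n.+1 u; rewrite sE in h1.
apply: (le_trans (nrm_triangle (sysD Sigma u + l *: sysC Sigma t) _ _)).
rewrite mulrDl; apply: lerD.
  apply: (le_trans h1); rewrite ler_wpM2l //.
  apply: (@le_trans _ _ (nrm l ^+ n)).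
    by rewrite exprSr ler_piMr ?exprn_ge0 // ltW.
  by rewrite lerXn2r ?nnegrE //; [case/andP: b01 | rewrite lerDr].
rewrite opprD addrACA subrr add0r -scalerBr -linearB nrmZ.
rewrite /K2 -!mulrA ler_wpM2l // (le_trans (hMC _)) // ler_wpM2l //.
rewrite nrm_distC (le_trans (hV n x)) // -mulrA.
rewrite ler_wpM2l //; first by rewrite invr_ge0 subr_ge0 ltW.
rewrite ler_wpM2l ?nrm_ge0 //.
by rewrite lerXn2r ?nnegrE //; [case/andP: b01 | rewrite lerDl].
Qed.
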